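(* Let $\{P_n(x)\}_{n\ge 0}$ be a $d$-orthogonal polynomial sequence, with respect to the vector functional $(\mathcal L_0,\dots,\mathcal L_{d-1})$, with $\deg P_n=n$ and leading coefficient $[x^n]P_n(x)\neq 0$. Let $A=(a_{n,k})_{n,k\ge 0}$ be its coefficient matrix defined by $P_n(x)=\sum_{k=0}^n a_{n,k}x^k$. Then the following hold. (i) The matrix $A$ is lower triangular with nonzero diagonal entries, hence invertible, and $A^{-1}$ exists. (ii) The production matrix $P$ of $A^{-1}$, $P=A\,\overline{A^{-1}}$ (where $\overline{A^{-1}}$ is $A^{-1}$ with its first row removed), is a $(d+2)$-banded (lower Hessenberg) matrix, i.e. $P_{i,j}=0$ for $j>i+1$ or $i-j>d$. (iii) The matrix $P$ encodes the $(d+2)$-term recurrence relation of $\{P_n(x)\}$: $$xP_n(x)=P_{n+1}(x)+\beta_nP_n(x)+\sum_{k=1}^{d}\gamma_{n,k}P_{n-k}(x),\qquad n\ge d,$$ where the coefficients $\beta_n,\gamma_{n,k}$ are given by the entries of $P$. (iv) The first $d$ columns of $A^{-1}$ represent the moments of the vector functional $(\mathcal L_0,\dots,\mathcal L_{d-1})$, namely $$(A^{-1})_{n,r}=\langle\mathcal L_r,x^n\rangle,\qquad r=0,1,\dots,d-1,\quad n\ge 0.$$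
   Context: Let $\mathbb P$ be the space of polynomials over $\mathbb C$ and let $\mathcal L_0,\dots,\mathcal L_{d-1}$ be $d$ linear functionals on $\mathbb P$; $\langle\mathcal L,p\rangle$ denotes the value of $\mathcal L$ on $p$. A monic polynomial sequence $\{P_n(x)\}_{n\ge 0}$ is called $d$-orthogonal with respect to the vector functional $(\mathcal L_0,\dots,\mathcal L_{d-1})$ if, for every $r=0,1,\dots,d-1$ and all $m\ge 0$, $\langle\mathcal L_r,x^mP_n(x)\rangle=0$ whenever $n\ge md+r+1$, and $\langle\mathcal L_r,x^mP_{md+r}(x)\rangle\neq 0$. For an invertible infinite lower triangular matrix $B$, the production matrix associated with $B$ is $B^{-1}SB$, where $S=(\delta_{i+1,j})_{i,j\ge 0}$ is the shift matrix; $SB$ is $B$ with its first row removed. The notation $[x^n]P_n(x)$ means the coefficient of $x^n$ in $P_n(x)$.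
   Formalization: In (iv) the identity is stated for functionals normalized by ⟨L_r,P_k⟩=δ_{rk} for k≤r, since it fails otherwise (replace L_0 by 2L_0); for arbitrary functionals ⟨L_r,x^n⟩=Σ_{k≤r}(A^{-1})_{n,k}⟨L_r,P_k⟩ is proved instead. *)

(* Defs.v *)
From HB Require Import structures.
From mathcomp Require Import all_boot all_order all_algebra.
From mathcomp Require Import boolp classical_sets fsbigop reals.
From mathcomp Require Import complex.

Set Implicit Arguments.
Unset Strict Implicit.
Unset Printing Implicit Defensive.

Import GRing.Theory.
Local Open Scope ring_scope.
Local Open Scope classical_set_scope.

Section InfiniteMatrices.
Variable K : nzRingType.

Definition imx := nat -> nat -> K.

Implicit Types A B Q : imx.

Definition imx1 : imx := fun i j => (i == j)%:R.

(* The sum over all of nat is a sum over the (finite) support of its terms.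
   It is 0 by convention when the support is infinite, which cannot happen when
   the rows of A have finite support (e.g. A lower triangular or the shift). *)
Definition imx_mul A B : imx :=
  fun i j => \sum_(k \in [set: nat]) (A i k * B k j).

Definition imx_lower A : Prop := forall i j : nat, (i < j)%N -> A i j = 0.

Definition imx_inverse A B : Prop :=
  imx_mul A B =2 imx1 /\ imx_mul B A =2 imx1.

Definition imx_shift : imx := fun i j => (i.+1 == j)%:R.

Definition imx_behead B : imx := fun i j => B i.+1 j.

(* Q = B^-1 S B *)
Definition imx_production B Q : Prop :=
  exists2 C : imx, imx_inverse B C & Q =2 imx_mul C (imx_mul imx_shift B).

Definition coef_imx (p : nat -> {poly K}) : imx := fun n k => (p n)`_k.

End InfiniteMatrices.

Section DOrthogonality.
Variables (K : fieldType) (d : nat).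
Implicit Types (L : 'I_d -> {scalar {poly K}}) (p : nat -> {poly K}).

Definition d_orthogonal L p : Prop :=
  (forall n : nat, p n \is monic) /\
  (forall (r : 'I_d) (m : nat),
     (forall n : nat, (m * d + r + 1 <= n)%N -> L r ('X^m * p n) = 0) /\
     L r ('X^m * p (m * d + r)%N) != 0).

(* d-orthogonality determines (L_0, ..., L_{d-1}) only up to an invertible
   lower triangular change of functionals: it forces <L_r, P_k> = 0 for k > r
   but only <L_r, P_r> <> 0, and nothing for k < r.  This is the remaining
   normalization making L_r the r-th element of the dual sequence of p. *)
Definition normalized L p : Prop :=
  forall (r : 'I_d) (k : nat), (k <= r)%N -> L r (p k) = (k == r)%:R.

End DOrthogonality.

(* Main.v *)
Require Import Defs.
From HB Require Import structures.
From mathcomp Require Import all_boot all_order all_algebra.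
From mathcomp Require Import boolp classical_sets fsbigop reals.
From mathcomp Require Import complex.

Set Implicit Arguments.
Unset Strict Implicit.
Unset Printing Implicit Defensive.

Import GRing.Theory.
Local Open Scope ring_scope.

(* The inverse B of the coefficient matrix expresses the monomials in the basis
   (P_k), so X P_n = sum_k a_{n,k} X^{k+1} expands in that basis with the
   entries of row n of the production matrix as coefficients.  The expansion
   stops at n + 1 by degree, and d-orthogonality kills, by induction on j, the
   coefficient of P_j for j < n - d.  Applying L_r to the expansion of X^n gives
   the moments. *)

Lemma sum_ord_widen0 (V : nmodType) (F : nat -> V) (m n : nat) :
    (m <= n)%N -> (forall k, (m <= k)%N -> F k = 0) ->
  \sum_(k < m) F k = \sum_(k < n) F k.
Proof.
move=> le_mn F0; rewrite (big_ord_widen _ _ le_mn) big_mkcond /=.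
by apply: eq_bigr => k _; case: ltnP => // /F0 ->.
Qed.

(** The product sums over the support of its terms. If row [i] of [A] vanishes from [n] on, that
    support lies below [n], so the default value 0 for infinite supports never interferes. *)
Lemma imx_mulE (K : nzRingType) (A B : imx K) (n i j : nat) :
    (forall k, (n <= k)%N -> A i k = 0) ->
  imx_mul A B i j = \sum_(k < n) A i k * B k j.
Proof.
move=> A0; rewrite (@fsbig_ord _ _ _ n (fun k => A i k * B k j)); apply/esym.
apply: fsbig_widen => // k /= [_ /negP]; rewrite -leqNgt => /A0 ->.
exact: mul0r.
Qed.

Lemma imx_mul_lower (K : nzRingType) (A B : imx K) (i j : nat) :
    imx_lower A -> imx_mul A B i j = \sum_(k < i.+1) A i k * B k j.
Proof. by move=> Alow; apply: imx_mulE => k /Alow. Qed.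

Lemma imx_mul_shift (K : nzRingType) (B : imx K) :
  imx_mul (imx_shift K) B =2 imx_behead B.
Proof.
move=> i j; rewrite (@imx_mulE _ _ _ i.+2) => [|k lt_ik]; last first.
  by rewrite /imx_shift ltn_eqF.
rewrite big_ord_recr /= /imx_shift eqxx mul1r big1 ?add0r // => k _.
by rewrite gtn_eqF ?mul0r.
Qed.

(** Forward substitution in row [i] of [AB = 1]: earlier rows of [B] already vanish in column [j],
    which leaves [A i i * B i j = 0]. *)
Lemma imx_inverse_lower (K : idomainType) (A B : imx K) :
    imx_lower A -> (forall n, A n n != 0) -> imx_inverse A B -> imx_lower B.
Proof.
move=> Alow Ann [AB _] i j; elim/ltn_ind: i => i IH lt_ij.
have := AB i j; rewrite imx_mul_lower // /imx1 ltn_eqF // big_ord_recr /=.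
rewrite big1 ?add0r => [/eqP|k _]; last by rewrite IH ?mulr0 // (ltn_trans _ lt_ij).
by rewrite mulf_eq0 (negPf (Ann i)) => /eqP.
Qed.

Section PolynomialSequence.
Variables (K : fieldType) (p : nat -> {poly K}).
Hypothesis size_p : forall n, size (p n) = n.+1.
Let A := coef_imx p.

Lemma coef_imx_lower : imx_lower A.
Proof. by move=> i j lt_ij; rewrite /A /coef_imx nth_default // size_p. Qed.

Lemma coef_imx_diag n : A n n != 0.
Proof.
have -> : A n n = lead_coef (p n) by rewrite lead_coefE size_p.
by rewrite lead_coef_eq0 -size_poly_eq0 size_p.
Qed.

Lemma coef_imxE n : p n = \sum_(k < n.+1) A n k *: 'X^k.
Proof. by rewrite -poly_def -(size_p n) coefK. Qed.

(** Subtracting the multiple of [p n] that cancels the coefficient of degree [n] lowers the size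
    bound. *)
Lemma polyseq_span (n : nat) (q : {poly K}) : (size q <= n)%N ->
  exists c : nat -> K, q = \sum_(k < n) c k *: p k.
Proof.
elim: n q => [|n IH] q le_qn.
  by exists (fun=> 0); rewrite big_ord0; apply/eqP; rewrite -size_poly_leq0.
have [|c def_q] := IH (q - (q`_n / A n n) *: p n).
  apply/leq_sizeP => j; rewrite leq_eqVlt => /predU1P[<-|lt_nj].
    by rewrite coefB coefZ divfK ?subrr ?coef_imx_diag.
  rewrite coefB coefZ (nth_default _ (leq_trans le_qn lt_nj)).
  by rewrite (nth_default _ (_ : _ <= j)%N) ?size_p // mulr0 subr0.
exists (fun k => if k == n then q`_n / A n n else c k).
rewrite big_ord_recr /= eqxx -[LHS](subrK ((q`_n / A n n) *: p n)) def_q.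
by congr (_ + _); apply: eq_bigr => k _; rewrite ltn_eqF.
Qed.

Lemma polyseq_free (n : nat) (c : nat -> K) :
  \sum_(k < n) c k *: p k = 0 -> forall k, (k < n)%N -> c k = 0.
Proof.
elim: n => // n IH; rewrite big_ord_recr /= => sum0.
suff cn0 : c n = 0.
  move=> k; rewrite ltnS leq_eqVlt => /predU1P[-> //|]; apply: IH.
  by move: sum0; rewrite cn0 scale0r addr0.
have /eqP := congr1 (fun q : {poly K} => q`_n) sum0.
rewrite /= coefD coef_sum big1 => [|k _]; last first.
  by rewrite coefZ [_`_n](coef_imx_lower (ltn_ord k)) mulr0.
by rewrite coefZ coef0 add0r mulf_eq0 [_`_n == 0](negPf (coef_imx_diag n)) orbF => /eqP.
Qed.

Lemma polyX_expansion (B : imx K) : imx_lower B -> imx_mul B A =2 imx1 K ->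
  forall n, 'X^n = \sum_(k < n.+1) B n k *: p k.
Proof.
move=> Blow BA n; apply/polyP => j.
have := BA n j; rewrite imx_mul_lower // coefXn eq_sym -/(imx1 K n j) => <-.
by rewrite coef_sum; apply: eq_bigr => k _; rewrite coefZ.
Qed.

(** Row [n] of the inverse holds the coordinates of ['X^n] in the basis [p]. Comparing coefficients
    gives [BA = 1]; freeness of [p] gives [AB = 1]. *)
Lemma coef_imx_inverse : exists2 B : imx K, imx_lower B & imx_inverse A B.
Proof.
have /choice[c Xc] (n : nat) : exists c : nat -> K, 'X^n = \sum_(k < n.+1) c k *: p k.
  by apply: polyseq_span; rewrite size_polyXn.
(* Nothing is known of [c n k] for [k > n], hence the cut-off. *)
pose B : imx K := fun n k => if (k <= n)%N then c n k else 0.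
have Blow : imx_lower B by move=> i j lt_ij; rewrite /B leqNgt lt_ij.
have XB n : 'X^n = \sum_(k < n.+1) B n k *: p k.
  by rewrite Xc; apply: eq_bigr => k _; rewrite /B -ltnS ltn_ord.
exists B => //; split=> i j; last first.
  rewrite imx_mul_lower // /imx1 eq_sym -coefXn XB coef_sum.
  by apply: eq_bigr => k _; rewrite coefZ.
rewrite imx_mul_lower //; last exact: coef_imx_lower.
have [lt_ij|le_ji] := ltnP i j.
  rewrite /imx1 ltn_eqF // big1 // => k _; rewrite Blow ?mulr0 //.
  exact: leq_trans lt_ij.
(* [e l] is the coordinate along [p l] of the zero polynomial obtained by re-expanding the monomials
   of [p i] in the basis [p] and subtracting [p i]. *)
pose e l := \sum_(k < i.+1) A i k * B k l - imx1 K i l.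
apply/eqP; rewrite -subr_eq0; apply/eqP.
apply: (polyseq_free (n := i.+1) (c := e)); last by rewrite ltnS.
rewrite /e; under eq_bigr do rewrite scalerBl scaler_suml.
rewrite sumrB exchange_big /= [X in _ - X]big_ord_recr /=.
rewrite /imx1 eqxx scale1r [X in _ - (X + _)]big1 ?add0r => [|l _]; last first.
  by rewrite gtn_eqF ?scale0r.
apply/eqP; rewrite subr_eq0 [p i]coef_imxE; apply/eqP/eq_bigr => k _.
rewrite XB scaler_sumr (sum_ord_widen0 (n := i.+1) (F := fun l => A i k *: (B k l *: p l))) //.
  by apply: eq_bigr => l _; rewrite scalerA.
by move=> l lt_kl; rewrite Blow // scale0r scaler0.
Qed.

Variable B : imx K.
Hypothesis AB_inv : imx_inverse A B.
Let P := imx_mul A (imx_behead B).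
Let Blow : imx_lower B.
Proof. exact: imx_inverse_lower coef_imx_lower coef_imx_diag AB_inv. Qed.

Lemma production_coefE i j : P i j = \sum_(k < i.+1) A i k * B k.+1 j.
Proof. by rewrite /P imx_mul_lower //; apply: coef_imx_lower. Qed.

Lemma imx_production_coef : imx_production B P.
Proof.
exists A; first by case: AB_inv.
move=> i j; rewrite production_coefE imx_mul_lower; last exact: coef_imx_lower.
by apply: eq_bigr => k _; rewrite imx_mul_shift.
Qed.

Lemma production_hessenberg i j : (i.+1 < j)%N -> P i j = 0.
Proof.
move=> lt_ij; rewrite production_coefE big1 // => k _.
by rewrite Blow ?mulr0 // (leq_ltn_trans _ lt_ij).
Qed.

(** Only the term [k = n] survives by triangularity, and the diagonal entries of [A] and [B] are
    reciprocal. *)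
Lemma production_superdiag n : P n n.+1 = A n n / A n.+1 n.+1.
Proof.
have BA : B n.+1 n.+1 * A n.+1 n.+1 = 1.
  have := AB_inv.2 n.+1 n.+1; rewrite imx_mul_lower // /imx1 eqxx mulr1n => <-.
  rewrite big_ord_recr /= big1 ?add0r // => k _.
  by rewrite (coef_imx_lower (ltn_ord k)) mulr0.
rewrite production_coefE big_ord_recr /= big1 ?add0r => [|k _]; last first.
  by rewrite Blow ?mulr0 // ltnS.
by apply: (canRL (mulfK (coef_imx_diag _))); rewrite -mulrA BA mulr1.
Qed.

Lemma mulX_production n : 'X * p n = \sum_(j < n.+2) P n j *: p j.
Proof.
rewrite {1}coef_imxE mulr_sumr.
under [RHS]eq_bigr do rewrite production_coefE scaler_suml.
rewrite exchange_big /=; apply: eq_bigr => k _.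
rewrite -scalerAr -exprS (polyX_expansion Blow AB_inv.2) scaler_sumr.
rewrite (sum_ord_widen0 (n := n.+2) (F := fun l => A n k *: (B k.+1 l *: p l)))
  ?ltnS ?leq_ord //.
  by apply: eq_bigr => l _; rewrite scalerA.
by move=> l lt_kl; rewrite Blow // scale0r scaler0.
Qed.

Section Functionals.
Variables (d : nat) (L : 'I_d -> {scalar {poly K}}).
Hypotheses (d_gt0 : (0 < d)%N) (p_orth : d_orthogonal L p).

(* Writing j = m d + r, the functional q |-> L_r (X^m q) kills all p_k with
   k > j, does not kill p_j, and kills X p_n as soon as n > j + d. *)
Lemma production_band n j : (j + d < n)%N -> P n j = 0.
Proof.
elim/ltn_ind: j => j IH lt_jn.
pose r := Ordinal (ltn_pmod j d_gt0); pose m := (j %/ d)%N.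
have def_j : j = (m * d + r)%N := divn_eq j d.
have [_ orth] := p_orth; have [L0 Lj] := orth r m; rewrite -def_j in L0 Lj.
have : L r ('X^m * ('X * p n)) = 0.
  rewrite mulrA -exprSr; apply: (orth r m.+1).1.
  by rewrite mulSn addn1 -addnA -def_j addnC.
have lt_jn2 : (j < n.+2)%N.
  exact: leq_trans (leq_ltn_trans (leq_addr d j) lt_jn) (leqW (leqnSn n)).
(* Terms with [k < j] vanish by induction and those with [k > j] by orthogonality, so [P n j] times
   a nonzero value is 0. *)
rewrite mulX_production mulr_sumr linear_sum (bigD1 (Ordinal lt_jn2)) //= big1.
  by rewrite addr0 -scalerAr linearZ => /eqP; rewrite mulf_eq0 (negPf Lj) orbF => /eqP.
move=> k; rewrite -val_eqE /= neq_ltn => /orP[lt_kj|lt_jk].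
  by rewrite IH ?scale0r ?mulr0 ?linear0 // (leq_ltn_trans _ lt_jn) // leq_add2r ltnW.
by rewrite -scalerAr linearZ /= L0 ?mulr0 // addn1.
Qed.

Lemma d_orthogonal_moments (r : 'I_d) n :
  L r 'X^n = \sum_(k < r.+1) B n k * L r (p k).
Proof.
have [_ orth] := p_orth; have [L0 _] := orth r 0%N.
rewrite (polyX_expansion Blow AB_inv.2) linear_sum /=.
under eq_bigr do rewrite linearZ /=.
(* As [n] and [r] are not ordered, both sums are padded to the larger length: one by triangularity
   of [B], the other by orthogonality with [m = 0]. *)
pose F k := B n k * L r (p k).
rewrite (sum_ord_widen0 (F := F) (leq_maxl n.+1 r.+1)) => [|k lt_nk]; last first.
  by rewrite /F Blow ?mul0r.
rewrite -(sum_ord_widen0 (F := F) (leq_maxr n.+1 r.+1)) // => k lt_rk.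
by rewrite /F -[p k]mul1r -(expr0 'X) L0 ?mulr0 // mul0n addn1.
Qed.

Lemma d_orthogonal_recurrence n : (d <= n)%N ->
  'X * p n = P n n.+1 *: p n.+1 + P n n *: p n
             + \sum_(1 <= k < d.+1) P n (n - k)%N *: p (n - k)%N.
Proof.
move=> le_dn; rewrite mulX_production 2!big_ord_recr /= addrC.
rewrite (addrC (\sum_(_ < _) _)) addrA; congr (_ + _).
pose F j := P n j *: p j.
(* The band property kills the indices below [n - d]; the [d] remaining ones are reversed to the
   form [n - k]. *)
rewrite -(big_mkord xpredT F) (big_cat_nat (n := (n - d)%N)) ?leq_subr //=.
rewrite big_nat_cond big1 ?add0r => [|j /andP[/andP[_ lt_j] _]]; last first.
  by rewrite /F production_band ?scale0r // addnC -ltn_subRL.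
by rewrite big_rev_mkord subKn // big_add1 big_mkord.
Qed.
End Functionals.
End PolynomialSequence.

Theorem theorem5p2 (R : realType) (d : nat) (L : 'I_d -> {scalar {poly R[i]}})
    (p : nat -> {poly R[i]})
    (d_gt0 : (0 < d)%N)
    (p_orth : d_orthogonal L p)
    (p_deg : forall n : nat, size (p n) = n.+1)
    (p_lead : forall n : nat, (p n)`_n != 0) :
  let A := coef_imx p in
  (* (i) *)
  [/\ imx_lower A, (forall n : nat, A n n != 0)
    & exists2 B : imx R[i], imx_lower B & imx_inverse A B] /\
  forall Ainv : imx R[i], imx_inverse A Ainv ->
    let P := imx_mul A (imx_behead Ainv) in
    (* (ii) *)
    (imx_production Ainv P /\
     forall i j : nat, (i + 1 < j)%N \/ (j + d < i)%N -> P i j = 0) /\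
    (* (iii) *)
    (forall n : nat, (d <= n)%N ->
       P n n.+1 = 1 /\
       'X * p n = p n.+1 + P n n *: p n
                  + \sum_(1 <= k < d.+1) P n (n - k)%N *: p (n - k)%N) /\
    (* (iv): moments of an arbitrary vector functional, then the normalized one *)
    (forall (r : 'I_d) (n : nat),
       L r 'X^n = \sum_(k < r.+1) Ainv n k * L r (p k)) /\
    (normalized L p ->
       forall (r : 'I_d) (n : nat), Ainv n r = L r 'X^n).
Proof.
split.
  split; [exact: coef_imx_lower | exact: p_lead | exact: coef_imx_inverse].
move=> B AB; split; last split; last split.
- split=> [|i j [lt_ij|lt_ji]]; first exact: imx_production_coef.
    by apply: production_hessenberg; rewrite // -addn1.
  exact: production_band p_orth _ _ lt_ji.
- move=> n le_dn; have Pn1 : imx_mul (coef_imx p) (imx_behead B) n n.+1 = 1.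
    (* Monicity makes the diagonal of the coefficient matrix 1, hence also the superdiagonal of the
       production matrix. *)
    have An k : coef_imx p k k = 1.
      by have /monicP := p_orth.1 k; rewrite lead_coefE p_deg.
    by rewrite production_superdiag // !An divr1.
  split=> //; rewrite (d_orthogonal_recurrence p_deg AB d_gt0 p_orth le_dn).
  by rewrite Pn1 scale1r.
- exact: d_orthogonal_moments.
move=> Lnorm r n; rewrite (d_orthogonal_moments p_deg AB p_orth).
(* Normalization leaves only the last term, [k = r]. *)
rewrite big_ord_recr /= big1 => [|k _].
  by rewrite Lnorm // eqxx mulr1 add0r.
by rewrite Lnorm ?ltn_eqF ?mulr0 // ltnW.
Qed.
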